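(* Let $\mathscr{F}=(F_1,\dots,F_M)$ be an ordered collection of $k$-CNFs over $x_1,\dots,x_n$. Then for all $\ell,t\ge1$, \[\Pr_{\boldsymbol\rho\leftarrow\mathcal{R}_p}\big[\operatorname{depth}(\mathrm{CCDT}_\ell(\mathscr{F}\upharpoonright\boldsymbol\rho))\ge t\big]\le M^{\lceil t/\ell\rceil}(32pk)^t.\]
   Context: A restriction is $\rho\in\{0,1,*\}^n$; $f\upharpoonright\rho$ fixes $x_i$ to $\rho_i$ when $\rho_i\in\{0,1\}$ and leaves it free when $\rho_i=*$; for a list $\mathscr{F}$, $\mathscr{F}\upharpoonright\rho=(F_1\upharpoonright\rho,\dots,F_M\upharpoonright\rho)$. $\mathcal{R}_p$ sets each coordinate independently to $0$ w.p. $(1-p)/2$, $1$ w.p. $(1-p)/2$, $*$ w.p. $p$. A $k$-CNF is an ordered sequence of clauses $C_1\wedge C_2\wedge\cdots$, each an OR of at most $k$ literals; under a restriction a clause is identically 1 if some literal is set true, identically 0 if all its literals are set false. Canonical decision tree $\mathrm{CDT}(F)$: if some clause is identically 0 it is the constant 0; if every clause is identically 1 it is the constant 1; otherwise let $C_{i_1}$ be the first clause not identically 1, with $\kappa$ surviving variables: query these $\kappa$ variables exhaustively in the first $\kappa$ levels, and at each leaf (assignment $\eta$) recursively place $\mathrm{CDT}(F\upharpoonright\eta)$. A path $\eta$ from the root in $\mathrm{CDT}(F)$ decomposes as segments $\eta^{(1)}\circ\cdots\circ\eta^{(u)}$, where $\eta^{(j)}$ assigns surviving variables of the clause $C_{i_j}$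 of $F\upharpoonright\eta^{(1)}\circ\cdots\circ\eta^{(j-1)}$ queried at that point (all of them for $j<u$); $\eta$ is full if $\eta^{(u)}$ also assigns all surviving variables of its clause. The set $\mathrm{CCDT}_\ell(\mathscr{F})$ of canonical common $\ell$-partial decision trees is defined inductively: (0) if $M=0$ it contains only the empty tree; (1) if $\operatorname{depth}(\mathrm{CDT}(F_1))\le\ell$ then $\mathrm{CCDT}_\ell(\mathscr{F})=\mathrm{CCDT}_\ell((F_2,\dots,F_M))$; (2) otherwise let $P$ be the set of full paths in $\mathrm{CDT}(F_1)$ of length between $\ell+1$ and $\ell+k$; for any $\eta\in P$, let $T_\eta$ query exhaustively all variables of $\eta$ in its first $|\eta|$ levels, and at the end of each path $\pi$ of $T_\eta$ attach any tree from $\mathrm{CCDT}_\ell(\mathscr{F}\upharpoonright\pi)$; $\mathrm{CCDT}_\ell(\mathscr{F})$ is the set of all trees so obtained (over all choices). $\operatorname{depth}(\mathrm{CCDT}_\ell(\mathscr{F}))$ is the maximum depth of a tree in this set. *)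

(* Defs.v *)
From HB Require Import structures.
From mathcomp Require Import all_boot all_order all_algebra.
From mathcomp Require Import boolp.

Set Implicit Arguments.
Unset Strict Implicit.
Unset Printing Implicit Defensive.

Import Order.TTheory GRing.Theory Num.Theory.
Local Open Scope nat_scope.

(* [None] is the star. *)
Definition restriction (n : nat) := {ffun 'I_n -> option bool}.

Section Restrictions.
Variable n : nat.
Implicit Types rho eta pi : restriction n.

Definition no_restr : restriction n := [ffun => None].

Definition set_var rho (i : 'I_n) (b : bool) : restriction n :=
  [ffun j => if j == i then Some b else rho j].

Definition dom rho : {set 'I_n} := [set i | rho i != None].

(* [comp rho eta] first applies [rho], then [eta] to what is left free, so that
   F restricted by rho and then by eta is F restricted by [comp rho eta]. *)
Definition comp rho eta : restriction n :=
  [ffun i => if rho i is Some b then Some b else eta i].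

Definition agrees (x : {ffun 'I_n -> bool}) rho : bool :=
  [forall i, (rho i == None) || (rho i == Some (x i))].

End Restrictions.

Arguments no_restr {n}.

(* The literal (i, true) is x_i and (i, false) is its negation. *)
Definition clause (n : nat) := {set 'I_n * bool}.
Definition cnf (n : nat) := seq (clause n).

Section CNF.
Variable n : nat.
Implicit Types (rho : restriction n) (C : clause n) (F : cnf n).

Definition kcnf (k : nat) F : bool := all (fun C => #|C| <= k) F.

Definition clause_eval C (x : {ffun 'I_n -> bool}) : bool :=
  [exists l in C, x l.1 == l.2].

(* C restricted by rho is identically b.  See [identically0E],
   [identically1_lit] and [identically1E] for the reading in terms of literals;
   a clause containing some x_i together with its negation is identically 1. *)
Definition identically (b : bool) rho C : bool :=
  [forall x, agrees x rho ==> (clause_eval C x == b)].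

Definition surviving rho C : {set 'I_n} :=
  [set i | (rho i == None) && [exists b, (i, b) \in C]].

Definition has_zero F rho : bool := has (identically false rho) F.

Definition first_open F rho : option (clause n) :=
  ohead [seq C <- F | ~~ identically true rho C].

Lemma agrees_ext rho (y : 'I_n -> bool) :
  agrees [ffun i => odflt (y i) (rho i)] rho.
Proof. by apply/forallP => i; rewrite ffunE; case: (rho i) => [b|] /=; rewrite ?eqxx. Qed.

Lemma identically0E rho C :
  identically false rho C = [forall l in C, rho l.1 == Some (~~ l.2)].
Proof.
apply/forallP/forall_inP => [H l lC | H x].
  have := H [ffun i => odflt l.2 (rho i)].
  rewrite (agrees_ext rho (fun=> l.2)) /= => /eqP/negbT.
  rewrite negb_exists_in => /forall_inP /(_ l lC); rewrite ffunE.
  by case: (rho l.1) => [b|] /=; rewrite ?eqxx //; case: b l.2 => -[].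
apply/implyP => /forallP ax; rewrite eqbF_neg negb_exists_in.
apply/forall_inP => l lC; have := ax l.1; rewrite (eqP (H l lC)) /=.
by case/eqP=> <-; case: l.2.
Qed.

Lemma identically1_lit rho C l :
  l \in C -> rho l.1 = Some l.2 -> identically true rho C.
Proof.
move=> lC rl; apply/forallP => x; apply/implyP => /forallP /(_ l.1).
rewrite rl /= => /eqP [lx]; apply/eqP/exists_inP; exists l => //.
by rewrite -lx.
Qed.

Lemma identically1E rho C :
  (forall i, ~~ (((i, true) \in C) && ((i, false) \in C))) ->
  identically true rho C = [exists l in C, rho l.1 == Some l.2].
Proof.
move=> ntaut; apply/idP/exists_inP => [/forallP H|[l lC /eqP rl]]; last first.
  exact: identically1_lit rl.
have := H [ffun i => odflt ((i, false) \in C) (rho i)].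
rewrite (agrees_ext rho (fun i => (i, false) \in C)) /=.
move=> /eqP/exists_inP[[i b] lC]; rewrite ffunE /= => /eqP xib.
exists (i, b) => //=; move: xib (ntaut i).
case: (rho i) => [c|] /= => [->|xib] //.
by case: b lC xib => lC; rewrite lC // => ->.
Qed.

End CNF.

Inductive dtree (n : nat) (L : Type) : Type :=
| Leaf of L
| Query of 'I_n & dtree n L & dtree n L.

Fixpoint depth (n : nat) (L : Type) (T : dtree n L) : nat :=
  if T is Query _ T0 T1 then (maxn (depth T0) (depth T1)).+1 else 0.

(* The tree querying all of [vs] (on top of the answers already recorded in
   [pi]) and continuing with [sub pi'] at the end of the path pi'. *)
Fixpoint query_all (n : nat) (L : Type) (vs : seq 'I_n) (pi : restriction n)
    (sub : restriction n -> dtree n L) : dtree n L :=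
  if vs is v :: vs' then
    Query v (query_all vs' (set_var pi v false) sub)
            (query_all vs' (set_var pi v true) sub)
  else sub pi.

Definition exhaustive (n : nat) (L : Type) (S : {set 'I_n})
    (sub : restriction n -> dtree n L) : dtree n L :=
  query_all (enum S) no_restr sub.

Fixpoint CDT_rec (n m : nat) (F : cnf n) (rho : restriction n)
    : dtree n bool :=
  if has_zero F rho then Leaf n false else
  if first_open F rho is Some C then
    if m is m'.+1 then
      exhaustive (surviving rho C) (fun eta => CDT_rec m' F (comp rho eta))
    else Leaf n false
  else Leaf n true.

(* The canonical decision tree of F restricted by rho.  Every round queries at
   least one variable, so n rounds suffice: the defining equation is
   [CDT_unfold]. *)
Definition CDT (n : nat) (F : cnf n) (rho : restriction n) : dtree n bool :=
  CDT_rec n F rho.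

(* [full_path F rho eta]: eta is a full path of the canonical decision tree of
   F restricted by rho, i.e. a composition of segments each of which assigns
   exactly the surviving variables of the clause queried at that point. *)
Inductive full_path (n : nat) (F : cnf n) (rho : restriction n)
    : restriction n -> Prop :=
| full_nil : full_path F rho no_restr
| full_cons (C : clause n) (eta1 eta2 : restriction n) :
    ~~ has_zero F rho -> first_open F rho = Some C ->
    dom eta1 = surviving rho C ->
    full_path F (comp rho eta1) eta2 ->
    full_path F rho (comp eta1 eta2).

(* [CCDT k l Fs rho T]: T is a canonical common l-partial decision tree of the
   list Fs restricted by rho. *)
Inductive CCDT (n k l : nat)
    : seq (cnf n) -> restriction n -> dtree n unit -> Prop :=
| CCDT_nil (rho : restriction n) : CCDT k l [::] rho (Leaf n tt)
| CCDT_skip (F : cnf n) (Fs : seq (cnf n)) (rho : restriction n)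
    (T : dtree n unit) :
    depth (CDT F rho) <= l ->
    CCDT k l Fs rho T -> CCDT k l (F :: Fs) rho T
| CCDT_query (F : cnf n) (Fs : seq (cnf n)) (rho eta : restriction n)
    (sub : restriction n -> dtree n unit) :
    l < depth (CDT F rho) ->
    full_path F rho eta -> l + 1 <= #|dom eta| <= l + k ->
    (forall pi : restriction n, dom pi = dom eta ->
       CCDT k l (F :: Fs) (comp rho pi) (sub pi)) ->
    CCDT k l (F :: Fs) rho (exhaustive (dom eta) sub).

(* The maximum depth of a tree in the set; by [CCDT_depth_le] no such tree has
   depth more than n, so the bound on d is harmless (see [leq_CCDT_depth]). *)
Definition CCDT_depth (n k l : nat) (Fs : seq (cnf n)) (rho : restriction n)
    : nat :=
  \max_(d < n.+1 | `[< exists2 T, CCDT k l Fs rho T & depth T = d >]) d.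

Section Facts.
Variable n : nat.
Implicit Types (rho eta pi : restriction n) (F : cnf n).

Lemma dom_comp rho eta : dom (comp rho eta) = dom rho :|: dom eta.
Proof. by apply/setP => i; rewrite !inE ffunE; case: (rho i). Qed.

Lemma dom_set_var rho i b : dom (set_var rho i b) = i |: dom rho.
Proof. by apply/setP => j; rewrite !inE ffunE; case: (j == i). Qed.

Lemma dom_no_restr : dom (@no_restr n) = set0.
Proof. by apply/setP => j; rewrite !inE ffunE. Qed.

Lemma eq_query_all L (vs : seq 'I_n) pi (f g : restriction n -> dtree n L) :
  (forall pi', dom pi' = dom pi :|: [set v in vs] -> f pi' = g pi') ->
  query_all vs pi f = query_all vs pi g.
Proof.
elim: vs pi => [|v vs IH] pi H /=.
  by apply: H; apply/setP => i; rewrite !inE orbF.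
by congr Query; apply: IH => pi'; rewrite dom_set_var => E; apply: H;
  rewrite E; apply/setP => i; rewrite !inE orbCA orbA.
Qed.

Lemma eq_exhaustive L (S : {set 'I_n}) (f g : restriction n -> dtree n L) :
  (forall pi, dom pi = S -> f pi = g pi) -> exhaustive S f = exhaustive S g.
Proof.
move=> H; apply: eq_query_all => pi E; apply: H; rewrite E dom_no_restr.
by apply/setP => i; rewrite !inE mem_enum.
Qed.

Lemma depth_query_all L (vs : seq 'I_n) pi (f : restriction n -> dtree n L) d :
  (forall pi', dom pi' = dom pi :|: [set v in vs] -> depth (f pi') <= d) ->
  depth (query_all vs pi f) <= size vs + d.
Proof.
elim: vs pi => [|v vs IH] pi H /=.
  by apply: H; apply/setP => i; rewrite !inE orbF.
by rewrite addSn ltnS geq_max; apply/andP; split; apply: IH => pi';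
  rewrite dom_set_var => E; apply: H; rewrite E; apply/setP => i;
  rewrite !inE orbCA orbA.
Qed.

Lemma depth_exhaustive L (S : {set 'I_n}) (f : restriction n -> dtree n L) d :
  (forall pi, dom pi = S -> depth (f pi) <= d) ->
  depth (exhaustive S f) <= #|S| + d.
Proof.
move=> H; rewrite cardE; apply: depth_query_all => pi E; apply: H.
by rewrite E dom_no_restr; apply/setP => i; rewrite !inE mem_enum.
Qed.

Lemma first_open_in F rho C :
  first_open F rho = Some C -> C \in F /\ ~~ identically true rho C.
Proof.
rewrite /first_open => H.
suff : C \in [seq C <- F | ~~ identically true rho C].
  by rewrite mem_filter => /andP[].
by case: [seq _ <- _ | _] H => //= D s [->]; rewrite mem_head.
Qed.

Lemma surviving_neq0 F rho C :
  ~~ has_zero F rho -> first_open F rho = Some C -> surviving rho C != set0.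
Proof.
move=> /hasPn nz /first_open_in[CF n1]; have := nz C CF.
rewrite identically0E => /forall_inPn[[i b] lC /= rl].
apply/set0Pn; exists i; rewrite inE; apply/andP; split; last first.
  by apply/existsP; exists b.
case E: (rho i) rl => [c|] // cb; case/negP: n1.
by apply: identically1_lit lC _; rewrite /= E; case: c b cb {E} => -[].
Qed.

Lemma dom_surviving rho C : [disjoint dom rho & surviving rho C].
Proof.
rewrite -setI_eq0; apply/eqP/setP => i; rewrite !inE.
by case: (rho i).
Qed.

Lemma ltn_dom_comp F rho eta C :
  ~~ has_zero F rho -> first_open F rho = Some C ->
  dom eta = surviving rho C -> #|dom rho| < #|dom (comp rho eta)|.
Proof.
move=> nz fo de; rewrite dom_comp de cardsU.
rewrite (disjoint_setI0 (dom_surviving rho C)) cards0 subn0.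
by rewrite -[ltnLHS]addn0 ltn_add2l card_gt0 (surviving_neq0 nz fo).
Qed.

Lemma card_dom rho : #|dom rho| <= n.
Proof. by rewrite -[leqRHS]card_ord max_card. Qed.

Lemma open_ltn F rho C :
  ~~ has_zero F rho -> first_open F rho = Some C -> #|dom rho| < n.
Proof.
move=> nz fo; have /set0Pn[i] := surviving_neq0 nz fo.
rewrite inE => /andP[ri _].
rewrite -[ltnRHS]card_ord -cardsT; apply: proper_card.
by apply/properP; split; [exact: subsetT | exists i; rewrite ?inE ?negbK].
Qed.

Lemma CDT_rec_fuel F rho m1 m2 :
  n <= #|dom rho| + m1 -> n <= #|dom rho| + m2 ->
  CDT_rec m1 F rho = CDT_rec m2 F rho.
Proof.
elim: m1 m2 rho => [|m1 IH] [|m2] rho h1 h2 //=;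
  case: ifPn => // nz; case fo: (first_open F rho) => [C|] //.
- by move: h1; rewrite addn0 leqNgt (open_ltn nz fo).
- by move: h2; rewrite addn0 leqNgt (open_ltn nz fo).
apply: eq_exhaustive => pi de; have lt := ltn_dom_comp nz fo de.
by apply: IH; [move: h1 | move: h2]; rewrite addnS -addSn => /leq_trans; apply;
  rewrite leq_add2r.
Qed.

Lemma CDT_unfold F rho :
  CDT F rho =
  if has_zero F rho then Leaf n false else
  if first_open F rho is Some C then
    exhaustive (surviving rho C) (fun eta => CDT F (comp rho eta))
  else Leaf n true.
Proof.
rewrite /CDT (@CDT_rec_fuel F rho n n.+1) ?leq_addl //.
  by rewrite addnS leqW // leq_addl.
Qed.

Lemma full_path_disjoint F rho eta :
  full_path F rho eta -> [disjoint dom rho & dom eta].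
Proof.
elim=> {eta} [rho0|rho0 C eta1 eta2 nz fo de _ IH].
  by rewrite dom_no_restr -setI_eq0 setI0.
rewrite dom_comp -setI_eq0 setIUr de; apply/eqP.
rewrite (disjoint_setI0 (dom_surviving rho0 C)) set0U.
by apply: disjoint_setI0; apply: disjointWl IH; rewrite dom_comp subsetUl.
Qed.

Lemma CCDT_depth_le k l Fs rho T :
  CCDT k l Fs rho T -> depth T <= n - #|dom rho|.
Proof.
elim=> {Fs rho T} // F Fs rho eta sub _ fp _ _ IH.
have dj := disjoint_setI0 (full_path_disjoint fp).
have E pi : dom pi = dom eta ->
    #|dom (comp rho pi)| = #|dom rho| + #|dom eta|.
  by move=> de; rewrite dom_comp de cardsU dj cards0 subn0.
apply: (@leq_trans (#|dom eta| + (n - (#|dom rho| + #|dom eta|)))).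
  by apply: depth_exhaustive => pi de; rewrite -(E pi de); apply: IH.
rewrite subnDA subnKC // leq_subRL ?card_dom // -(E eta erefl).
exact: card_dom.
Qed.

Lemma leq_CCDT_depth k l Fs rho t : 0 < t ->
  t <= CCDT_depth k l Fs rho <-> exists2 T, CCDT k l Fs rho T & t <= depth T.
Proof.
move=> t0; split=> [|[T HT tT]]; last first.
  have lt : depth T < n.+1.
    by rewrite ltnS; apply: leq_trans (CCDT_depth_le HT) (leq_subr _ _).
  apply: leq_trans tT _.
  apply: (@leq_bigmax_cond _ _ (fun d : 'I_n.+1 => d : nat) (Ordinal lt)).
  by apply/asboolP; exists T.
apply: contraPP => H; apply/negP; rewrite -ltnNge.
case: t t0 H => // t _ H; rewrite ltnS; apply/bigmax_leqP => d /asboolP[T HT E].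
by rewrite leqNgt; apply/negP => td; apply: H; exists T => //; rewrite E.
Qed.

End Facts.

Section Probability.
Local Open Scope ring_scope.

Definition Rp_weight (R : realFieldType) (n : nat) (p : R)
    (rho : restriction n) : R :=
  \prod_(i < n) (if rho i is Some _ then (1 - p) / 2 else p).

Definition Pr_Rp (R : realFieldType) (n : nat) (p : R)
    (E : pred (restriction n)) : R :=
  \sum_(rho | E rho) Rp_weight p rho.

Lemma Pr_Rp_total (R : realFieldType) (n : nat) (p : R) :
  Pr_Rp p (predT : pred (restriction n)) = 1.
Proof.
rewrite /Pr_Rp /Rp_weight.
rewrite -(bigA_distr_bigA (fun (_ : 'I_n) (o : option bool) =>
  if o is Some _ then (1 - p) / 2 else p)) big1 // => i _.
rewrite (bigD1 None) //= (bigD1 (Some true)) //= (bigD1 (Some false)) //=.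
rewrite big1 ?addr0; last by case=> [[]|].
by rewrite -splitr addrC subrK.
Qed.

End Probability.

Definition ceil_div (t l : nat) : nat := (t + l.-1) %/ l.

(* Main.v *)
Require Import Defs.
From mathcomp Require Import all_boot all_order all_algebra.
From mathcomp Require Import boolp zify ring lra.
Import Order.TTheory GRing.Theory Num.Theory Defs.
Local Open Scope ring_scope.

Set Implicit Arguments.
Unset Strict Implicit.
Unset Printing Implicit Defensive.

(** Razborov's encoding.  If a common partial tree of [Fs] restricted by [rho]
    has depth at least [t], one of its branches is made of blocks, each
    answering the variables of a full path in the canonical tree of some [F]
    in [Fs]; cut the last full path so that [t] variables remain.  All blocks
    but the last have more than [l] variables, so there are at most [t / l]
    (rounded up) of them.  Encode [rho] by additionally setting these [t]
    variables so as to falsify the clauses that the full paths query.  A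
    falsified clause stays the first open one, so [rho] can be recovered block
    by block, replacing the falsifying values by the answers of the full path,
    and at the end of a block by those of the branch, from the formulas of the
    blocks ([M] choices each) and, for each variable, its position in the
    clause, the two answers, and whether a clause or a block ends there
    ([k * 2 * 2 * 3] choices).  The encoding is heavier than [rho] by the
    factor [((1 - p) / (2 p)) ^ t], which bounds the probability by
    [M ^ ceil_div t l * (24 p k / (1 - p)) ^ t]; this suffices when
    [32 p k < 1], as then [1 - p >= 3 / 4], and otherwise the claim is
    trivial. *)

(** * Setting and starring variables; stability of the first open clause *)

Section Restrict.
Local Open Scope nat_scope.
Variable n : nat.
Implicit Types (rho tau sigma eta : restriction n) (S : {set 'I_n}).
Implicit Types (x y : 'I_n -> bool) (C : clause n) (F : cnf n).

Definition assign S x : restriction n :=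
  [ffun i => if i \in S then Some (x i) else None].

Definition clear S rho : restriction n :=
  [ffun i => if i \in S then None else rho i].

Lemma dom_assign S x : dom (assign S x) = S.
Proof. by apply/setP => i; rewrite inE ffunE; case: (i \in S). Qed.

Lemma assign_dom eta : eta = assign (dom eta) (fun i => odflt false (eta i)).
Proof. by apply/ffunP => i; rewrite ffunE inE; case: (eta i). Qed.

Lemma notin_dom eta i : (i \notin dom eta) = (eta i == None).
Proof. by rewrite inE negbK. Qed.

Lemma comp_no_restr rho : comp rho no_restr = rho.
Proof. by apply/ffunP => i; rewrite !ffunE; case: (rho i). Qed.

Lemma clear_comp rho sigma :
  [disjoint dom rho & dom sigma] -> clear (dom sigma) (comp rho sigma) = rho.
Proof.
move=> dj; apply/ffunP => i; rewrite !ffunE; case: ifPn => [is_|].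
  by have /eqP -> : rho i == None by rewrite -notin_dom (disjointFl dj is_).
by rewrite notin_dom => /eqP ->; case: (rho i).
Qed.

Lemma identically_extend b rho tau C :
  (forall i, rho i != None -> tau i = rho i) ->
  identically b rho C -> identically b tau C.
Proof.
move=> ext /forallP H; apply/forallP => x; apply/implyP => /forallP ax.
have /implyP := H x; apply; apply/forallP => i.
by case: eqVneq => //= ri; have := ax i; rewrite ext // (negbTE ri).
Qed.

Lemma first_open_falsified F rho C : first_open F rho = Some C ->
  exists2 x : {ffun 'I_n -> bool}, agrees x rho & ~~ clause_eval C x.
Proof.
move=> /first_open_in[_]; rewrite negb_forall => /existsP[x].
by rewrite negb_imply => /andP[ax]; rewrite eqb_id; exists x.
Qed.

(** Clauses before [C] stay identically 1 under any extension, and [x] overridden by [tau] still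
    falsifies [C]. *)
Lemma first_open_persist F rho tau C (x : {ffun 'I_n -> bool}) :
  first_open F rho = Some C -> ~~ clause_eval C x ->
  (forall i, rho i != None -> tau i = rho i) ->
  (forall i b, (i, b) \in C -> tau i != None -> tau i = Some (x i)) ->
  first_open F tau = Some C.
Proof.
move=> fo cx ext tx.
have nt : ~~ identically true tau C.
  apply/negP => /forallP /(_ [ffun i => odflt (x i) (tau i)]).
  rewrite (agrees_ext tau x) /= => /eqP/exists_inP[[i b] lC /=].
  rewrite ffunE => xb; case/negP: cx; apply/exists_inP; exists (i, b) => //=.
  by case E: (tau i) xb (tx i b lC) => [c|] //= /eqP <- /(_ isT) [->].
elim: F fo => [|D F IH] //; rewrite /first_open /=.
case: (boolP (identically true rho D)) => /= [tD | _ [->]].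
  by rewrite (identically_extend ext tD); apply: IH.
by rewrite nt.
Qed.

End Restrict.

(** * The decoder and its action on one clause *)

Section Decode.
Local Open Scope nat_scope.
Variables n k : nat.
Implicit Types (rho tau sigma eta : restriction n) (S : {set 'I_n}).
Implicit Types (x y : 'I_n -> bool) (C : clause n) (F : cnf n).
Implicit Types (Fs : seq (cnf n)) (m : option bool).

(* A token [(j, a, b, m)] describes one queried variable: it occurs in the
   [j]-th literal of the clause being queried, and is answered [a] by the full
   path and [b] by the branch of the common tree; [m] is [None] inside a
   clause, [Some false] at the end of a clause, and [Some true] at the end of
   a full path. *)
Definition token := ('I_k * bool * bool * option bool)%type.

(* The formulas still to be used, the current restriction, and the answers, in
   the current clause resp. in the current full path, waiting to be written
   into it. *)
Definition state :=
  (seq (cnf n) * restriction n * restriction n * restriction n)%type.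

(** [comp] lets its first argument win, so the answers overwrite the falsifying values in [tau]. At
    the end of a full path, [pb] also overwrites the answers of that path. *)
Definition boundary m (s : state) : state :=
  let: (Fs, tau, eb, pb) := s in
  match m with
  | None => s
  | Some false => (Fs, comp eb tau, no_restr, pb)
  | Some true => (behead Fs, comp pb tau, no_restr, no_restr)
  end.

(** The set of encoded variables is enough: starring them in the encoding gives back the original
    restriction. *)
Fixpoint decode (ts : seq token) (s : state) : {set 'I_n} :=
  if ts is (j, a, b, m) :: ts' then
    let: (Fs, tau, eb, pb) := s in
    if obind (fun C : clause n => onth (enum C) j)
         (obind (fun F => first_open F tau) (ohead Fs)) is Some v
    then v.1 |: decode ts' (boundary m (Fs, tau, set_var eb v.1 a,
                                        set_var pb v.1 b))
    else set0
  else set0.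

Lemma comp_set_var (v : 'I_n) vs x eb :
  comp (assign [set i in vs] x) (set_var eb v (x v)) =
  comp (assign [set i in v :: vs] x) eb.
Proof.
apply/ffunP => i; rewrite !ffunE !inE.
by case: (i \in vs); case: eqVneq => // ->.
Qed.

Lemma clause_token C i b a c m : #|C| <= k -> (i, b) \in C ->
  exists tk : token, forall F tau ts Fs eb pb, first_open F tau = Some C ->
    decode (tk :: ts) (F :: Fs, tau, eb, pb) =
    i |: decode ts (boundary m (F :: Fs, tau, set_var eb i a, set_var pb i c)).
Proof.
move=> Ck iC.
have lt : index (i, b) (enum C) < k.
  by apply: leq_trans Ck; rewrite cardE index_mem mem_enum.
exists (Ordinal lt, a, c, m) => F tau ts Fs eb pb fo /=; rewrite fo /=.
suff -> : onth (enum C) (index (i, b) (enum C)) = Some (i, b) by [].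
have := iC; rewrite -mem_enum; elim: (enum C) => //= l s IH.
rewrite inE; case: (eqVneq l (i, b)) => [->|ne] //=.
Qed.

(** Only the last token carries [m]; until then [tau] is unchanged, so all tokens are looked up in
    the same clause. *)
Lemma decode_clause_seq C (vs : seq 'I_n) x y m : #|C| <= k ->
  (forall i, i \in vs -> exists b, (i, b) \in C) -> vs != [::] ->
  exists2 ts : seq token, size ts = size vs &
  forall F tau ts' Fs eb pb, first_open F tau = Some C ->
    decode (ts ++ ts') (F :: Fs, tau, eb, pb) =
    [set i in vs] :|:
      decode ts' (boundary m (F :: Fs, tau, comp (assign [set i in vs] x) eb,
                              comp (assign [set i in vs] y) pb)).
Proof.
move=> Ck; elim: vs => // v vs IH vC _.
have [b vbC] := vC v (mem_head _ _).
case: (eqVneq vs [::]) => [->|vs0].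
  have [tk dtk] := clause_token (x v) (y v) m Ck vbC.
  exists [:: tk] => // F tau ts' Fs eb pb fo.
  rewrite cat1s dtk // -!comp_set_var.
  have -> : [set i in [:: v]] = [set v] by apply/setP => i; rewrite !inE.
  congr (_ :|: decode _ (boundary _ (_, _, _, _)));
  by apply/ffunP => i; rewrite !ffunE inE.
have [|ts sts dts] := IH _ vs0.
  by move=> i ivs; apply: vC; rewrite inE ivs orbT.
have [tk dtk] := clause_token (x v) (y v) None Ck vbC.
exists (tk :: ts) => [|F tau ts' Fs eb pb fo]; first by rewrite /= sts.
by rewrite cat_cons dtk // dts // !comp_set_var set_cons setUA.
Qed.

Lemma decode_clause C S x y m : #|C| <= k ->
  (forall i, i \in S -> exists b, (i, b) \in C) -> S != set0 ->
  exists2 ts : seq token, size ts = #|S| &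
  forall F tau ts' Fs eb pb, first_open F tau = Some C ->
    decode (ts ++ ts') (F :: Fs, tau, eb, pb) =
    S :|: decode ts' (boundary m (F :: Fs, tau, comp (assign S x) eb,
                                  comp (assign S y) pb)).
Proof.
move=> Ck SC S0.
have [||ts sts dts] := @decode_clause_seq C (enum S) x y m Ck.
- by move=> i; rewrite mem_enum; apply: SC.
- by rewrite -size_eq0 -cardE cards_eq0.
by exists ts => [|F tau ts' Fs eb pb fo]; rewrite ?cardE // dts // set_enum.
Qed.

Lemma kcnf_first_open F rho C : kcnf k F -> first_open F rho = Some C ->
  #|C| <= k.
Proof. by move=> /allP kF /first_open_in[CF _]; apply: kF. Qed.

Lemma surviving_lit rho C i : i \in surviving rho C ->
  exists b, (i, b) \in C.
Proof. by rewrite inE => /andP[_ /existsP]. Qed.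

(* Falsifying part of the clause being queried keeps it the first open one,
   whatever is done to variables outside of it. *)
Lemma first_open_assign F rho C (x : {ffun 'I_n -> bool}) S sigma :
  first_open F rho = Some C -> agrees x rho -> ~~ clause_eval C x ->
  S \subset surviving rho C ->
  (forall i, i \in surviving rho C -> i \notin S -> sigma i = None) ->
  first_open F (comp (comp rho (assign S x)) sigma) = Some C.
Proof.
move=> fo /forallP ax cx SC sC; apply: (first_open_persist fo cx) => i.
  by rewrite !ffunE; case: (rho i).
move=> b iC; rewrite !ffunE; have := ax i.
case E: (rho i) => [c|] /= => [/eqP // | _].
case: ifPn => // iS; rewrite sC //.
by rewrite inE E /=; apply/existsP; exists b.
Qed.

Lemma full_cons_disjoint F rho C eta1 eta2 : dom eta1 = surviving rho C ->
  full_path F (comp rho eta1) eta2 ->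
  [disjoint dom rho & dom eta1] /\ [disjoint dom eta1 & dom eta2].
Proof.
move=> d1 /full_path_disjoint; rewrite dom_comp d1 => dj; split.
  exact: dom_surviving.
by apply: disjointWl dj; rewrite subsetUr.
Qed.

(** * Encoding cut and complete full paths *)

Lemma decode_partial F rho eta : kcnf k F -> full_path F rho eta ->
  forall s, s <= #|dom eta| ->
  exists sigma, exists ts : seq token,
  [/\ dom sigma \subset dom eta, #|dom sigma| = s, size ts = s &
      forall Fs pb,
        decode ts (F :: Fs, comp rho sigma, no_restr, pb) = dom sigma].
Proof.
move=> kF; elim=> {rho eta} [rho|rho C eta1 eta2 nz fo d1 fp IH] s.
  rewrite dom_no_restr cards0 leqn0 => /eqP ->; exists no_restr, [::].
  by rewrite dom_no_restr cards0 sub0set.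
have [dj1 dj2] := full_cons_disjoint d1 fp.
have [x ax cx] := first_open_falsified fo.
have Ck := kcnf_first_open kF fo.
case: (leqP s #|dom eta1|) => [s1 _ | s1 s2].
  case: (posnP s) => [->|s0].
    exists no_restr, [::].
    by rewrite dom_no_restr cards0 sub0set.
  have /set0Pn[S] : [set S : {set 'I_n} | S \subset dom eta1 & #|S| == s] != set0.
    by rewrite -card_gt0 cards_draws bin_gt0.
  rewrite inE => /andP[SE /eqP Ss].
  have SC : S \subset surviving rho C by rewrite -d1.
  have fo' : first_open F (comp rho (assign S x)) = Some C.
    rewrite -[comp _ _]comp_no_restr; apply: first_open_assign fo ax cx SC _.
    by move=> i _ _; rewrite ffunE.
  (* The encoding stops before any boundary, so the answers are never read and [x] is a
     placeholder. *)
  have [|| ts sts dts] := decode_clause x x None Ck (S := S).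
  - by move=> i iS; apply: (surviving_lit (subsetP SC i iS)).
  - by rewrite -card_gt0 Ss.
  exists (assign S x), ts; rewrite dom_assign dom_comp; split => //.
  - exact: subset_trans SE (subsetUl _ _).
  - by rewrite sts.
  by move=> Fs pb; have := dts _ _ [::] Fs no_restr pb fo'; rewrite cats0 /= setU0.
have {s2} : s - #|dom eta1| <= #|dom eta2|.
  rewrite leq_subLR; apply: leq_trans s2 _.
  by rewrite dom_comp cardsU leq_subr.
case/IH=> sigma2 [ts2 [sub2 card2 size2 dec2]].
have dj3 : [disjoint dom eta1 & dom sigma2] by apply: disjointWr sub2 dj2.
have fo' : first_open F (comp (comp rho (assign (dom eta1) x)) sigma2) = Some C.
  by apply: first_open_assign fo ax cx _ _ => [|i]; rewrite -d1 // => ->.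
have [|| ts sts dts] := decode_clause (fun i => odflt false (eta1 i)) x
  (Some false) Ck (S := dom eta1).
- by move=> i; rewrite d1; apply: surviving_lit.
- by rewrite d1 (surviving_neq0 nz fo).
exists (comp (assign (dom eta1) x) sigma2), (ts ++ ts2).
rewrite !dom_comp dom_assign; split.
- exact: setUS.
- by rewrite cardsU (disjoint_setI0 dj3) cards0 subn0 card2 subnKC // ltnW.
- by rewrite size_cat sts size2 subnKC // ltnW.
move=> Fs pb.
have -> : comp rho (comp (assign (dom eta1) x) sigma2)
        = comp (comp rho (assign (dom eta1) x)) sigma2.
  by apply/ffunP => i; rewrite !ffunE; case: (rho i).
rewrite dts //= comp_no_restr -assign_dom.
set tau := (tau in decode _ (_, tau, _, _)).
suff -> : tau = comp (comp rho eta1) sigma2 by rewrite dec2.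
apply/ffunP => i; rewrite !ffunE.
case: (boolP (i \in dom eta1)) => [i1|].
  have /eqP -> : rho i == None by rewrite -notin_dom (disjointFl dj1 i1).
  by move: i1; rewrite inE; case: (eta1 i).
by rewrite notin_dom => /eqP ->; case: (rho i).
Qed.

(* [sigma'] encodes the part of the branch below [eta], and [y] is the branch
   of the common tree along which it continues. *)
Lemma decode_full F rho eta y : kcnf k F -> full_path F rho eta ->
  dom eta != set0 ->
  exists2 sigma, dom sigma = dom eta & exists2 ts : seq token,
    size ts = #|dom eta| &
    forall sigma' ts' Fs pb, [disjoint dom eta & dom sigma'] ->
      decode (ts ++ ts') (F :: Fs, comp (comp rho sigma) sigma', no_restr, pb) =
      dom eta :|: decode ts'
        (Fs, comp (comp (assign (dom eta) y) pb) (comp rho sigma'),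
         no_restr, no_restr).
Proof.
move=> kF; elim=> {rho eta} [rho|rho C eta1 eta2 nz fo d1 fp IH].
  by rewrite dom_no_restr eqxx.
move=> _; have [dj1 dj2] := full_cons_disjoint d1 fp.
have [x ax cx] := first_open_falsified fo.
have Ck := kcnf_first_open kF fo.
have lit1 i : i \in dom eta1 -> exists b, (i, b) \in C.
  by rewrite d1; apply: surviving_lit.
have ne1 : dom eta1 != set0 by rewrite d1 (surviving_neq0 nz fo).
have fo' sigma : [disjoint dom eta1 & dom sigma] ->
    first_open F (comp (comp rho (assign (dom eta1) x)) sigma) = Some C.
  by move=> dj; apply: first_open_assign fo ax cx _ _ => [|i]; rewrite -d1 // => ->.
(* If nothing follows, the last token of this clause must end the full path; otherwise it ends only
   the clause. *)
case: (eqVneq (dom eta2) set0) => [e0|ne2].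
  have -> : eta2 = no_restr.
    apply/ffunP => i; rewrite ffunE; apply/eqP.
    by rewrite -notin_dom e0 inE.
  rewrite comp_no_restr.
  have [ts sts dts] := decode_clause x y (Some true) Ck lit1 ne1.
  exists (assign (dom eta1) x); first exact: dom_assign.
  exists ts => // sigma' ts' Fs pb dj; rewrite dts ?fo' //=.
  congr (_ :|: decode _ (_, _, _, _)); apply/ffunP => i; rewrite !ffunE.
  by case: (i \in dom eta1); case: (pb i); case: (rho i).
have [sigma2 ds2 [ts2 sts2 dts2]] := IH ne2.
have [ts sts dts] :=
  decode_clause (fun i => odflt false (eta1 i)) y (Some false) Ck lit1 ne1.
exists (comp (assign (dom eta1) x) sigma2).
  by rewrite !dom_comp dom_assign ds2.
exists (ts ++ ts2).
  by rewrite size_cat sts sts2 dom_comp cardsU (disjoint_setI0 dj2) cards0 subn0.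
move=> sigma' ts' Fs pb; rewrite dom_comp disjoints_subset subUset.
rewrite -!disjoints_subset => /andP[djs1 djs2].
have -> : comp (comp rho (comp (assign (dom eta1) x) sigma2)) sigma'
        = comp (comp rho (assign (dom eta1) x)) (comp sigma2 sigma').
  apply/ffunP => i; rewrite !ffunE.
  by case: (rho i) => //; case: ifP.
rewrite -catA dts; last first.
  by rewrite fo' // dom_comp disjoint_sym disjoints_subset subUset
    -!disjoints_subset ds2 ![[disjoint _ & dom eta1]]disjoint_sym dj2.
rewrite /= comp_no_restr -assign_dom.
set tau := (tau in decode _ (_, tau, _, _)).
have -> : tau = comp (comp (comp rho eta1) sigma2) sigma'.
  apply/ffunP => i; rewrite !ffunE.
  case: (boolP (i \in dom eta1)) => [i1|].
    have /eqP -> : rho i == None by rewrite -notin_dom (disjointFl dj1 i1).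
    by move: i1; rewrite inE; case: (eta1 i).
  by rewrite notin_dom => /eqP ->; case: (rho i).
rewrite dts2 // setUA; congr (_ :|: decode _ (_, _, _, _)).
apply/ffunP => i; rewrite !ffunE in_setU.
case: (boolP (i \in dom eta2)) => [_|_]; first by rewrite orbT.
rewrite orbF; case: (boolP (i \in dom eta1)) => // ; rewrite notin_dom => /eqP ->.
by case: (pb i); case: (rho i).
Qed.

(** * Encoding a branch of a common tree *)

Lemma ceil_div_step l s t : 0 < l -> l <= s -> s <= t ->
  (ceil_div (t - s) l).+1 <= ceil_div t l.
Proof.
move=> l0 ls st; rewrite /ceil_div -add1n -divnMDl // mul1n.
by apply: leq_div2r; lia.
Qed.

(* [Gs] lists the formulas at which the branch of depth [t] makes queries. *)
Lemma CCDT_encode l Fs rho T t : 0 < l -> all (kcnf k) Fs ->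
  CCDT k l Fs rho T -> t <= depth T ->
  exists sigma, exists ts : seq token, exists Gs : seq (cnf n),
  [/\ [disjoint dom rho & dom sigma], #|dom sigma| = t, size ts = t,
      size Gs <= ceil_div t l /\ {subset Gs <= Fs} &
      forall Es, decode ts (Gs ++ Es, comp rho sigma, no_restr, no_restr)
                 = dom sigma].
Proof.
move=> l0 kFs H; elim: H t kFs => {Fs rho T}
  [rho|F Fs rho T _ _ IH|F Fs rho eta sub _ fp le _ IH] t.
- rewrite leqn0 => _ /eqP ->; exists no_restr, [::], [::].
  by rewrite dom_no_restr cards0 disjoints_subset setC0 subsetT.
- move=> /= /andP[_ kFs] /(IH _ kFs)[sigma [ts [Gs [dj cs st [sG GF] dec]]]].
  exists sigma, ts, Gs; split => //; split => // G /GF.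
  by rewrite inE => ->; rewrite orbT.
move=> kFs tT; have /= /andP[kF _] := kFs.
have dj := full_path_disjoint fp.
case: (posnP t) => [-> | t0].
  exists no_restr, [::], [::].
  by rewrite dom_no_restr cards0 disjoints_subset setC0 subsetT.
case: (leqP t #|dom eta|) => [te|et].
  have [sigma [ts [sub_ cs st dec]]] := decode_partial kF fp te.
  exists sigma, ts, [:: F]; split => //.
  - exact: disjointWr sub_ dj.
  - split; last by move=> G; rewrite !inE => ->.
    by rewrite /= /ceil_div divn_gt0 // ; lia.
  by move=> Es; rewrite /= dec.
(* Were every subtree shallower, the whole tree would have depth at most [t.-1]. *)
have [pi dp tp] : exists2 pi, dom pi = dom eta & t - #|dom eta| <= depth (sub pi).
  apply: contrapT => nex; have : depth (exhaustive (dom eta) sub) <= t.-1.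
    rewrite -(@subnKC #|dom eta| t.-1); last by lia.
    apply: depth_exhaustive => pi dp; rewrite leqNgt; apply/negP => lt.
    by apply: nex; exists pi => //; lia.
  by lia.
have [sigma' [ts' [Gs [dj' cs' st' [sG GF] dec']]]] := IH pi dp _ kFs tp.
have ne0 : dom eta != set0 by rewrite -card_gt0; lia.
have [sigma ds [ts st dec]] :=
  decode_full (fun i => odflt false (pi i)) kF fp ne0.
move: dj'; rewrite dom_comp dp disjoints_subset subUset -!disjoints_subset.
move=> /andP[djr djs].
exists (comp sigma sigma'), (ts ++ ts'), (F :: Gs); rewrite dom_comp ds; split.
- by rewrite disjoint_sym disjoints_subset subUset -!disjoints_subset
    ![[disjoint _ & dom rho]]disjoint_sym dj.
- by rewrite cardsU (disjoint_setI0 djs) cards0 subn0 cs' subnKC // ltnW.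
- by rewrite size_cat st st' subnKC // ltnW.
- split=> [|G]; last by rewrite inE => /orP[/eqP ->|/GF //]; rewrite mem_head.
  apply: leq_trans (ceil_div_step l0 _ (ltnW et)); last by lia.
  by rewrite /= ltnS.
move=> Es; rewrite cat_cons.
have -> : comp rho (comp sigma sigma') = comp (comp rho sigma) sigma'.
  by apply/ffunP => i; rewrite !ffunE; case: (rho i).
rewrite dec // comp_no_restr -dp -assign_dom.
(* As [pi] and [rho] set disjoint variables, the decoder has reached the encoding made for
   [sub pi]. *)
have -> : comp pi (comp rho sigma') = comp (comp rho pi) sigma'.
  apply/ffunP => i; rewrite !ffunE; case: (boolP (i \in dom pi)) => [|].
    rewrite dp => ie.
    have /eqP -> : rho i == None by rewrite -notin_dom (disjointFl dj ie).
    by case: (pi i).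
  by rewrite notin_dom => /eqP ->; case: (rho i).
by rewrite dec'.
Qed.

Lemma card_token : #|{: token}| = 12 * k.
Proof. by rewrite !card_prod card_option card_bool card_ord; lia. Qed.

End Decode.

(** * Weights and the counting bound *)

Section Weight.
Variables (R : realFieldType) (n : nat) (p : R).
Hypothesis p01 : 0 <= p <= 1.
Implicit Types (rho : restriction n) (S : {set 'I_n}).

Lemma Rp_weight_ge0 rho : 0 <= Rp_weight p rho.
Proof.
have /andP[p0 p1] := p01.
by apply: prodr_ge0 => i _; case: (rho i) => // _; rewrite divr_ge0 ?subr_ge0.
Qed.

Lemma Pr_Rp_le1 (E : pred (restriction n)) : Pr_Rp p E <= 1.
Proof.
rewrite -(Pr_Rp_total n p) /Pr_Rp [leRHS](bigID E) /= lerDl.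
by apply: sumr_ge0 => rho _; apply: Rp_weight_ge0.
Qed.

(** Starring one set variable trades a factor [(1 - p) / 2] for [p]. *)
Lemma Rp_weight_clear S rho : p < 1 -> S \subset dom rho ->
  Rp_weight p (clear S rho) = Rp_weight p rho * (2 * p / (1 - p)) ^+ #|S|.
Proof.
move=> p1 /subsetP Sr; rewrite /Rp_weight -prodr_const.
rewrite [X in _ = _ * X]big_mkcond -big_split /=.
apply: eq_bigr => i _; rewrite ffunE; case: ifPn => [iS|_]; last by rewrite mulr1.
have := Sr i iS; rewrite inE; case: (rho i) => // b _.
by field; lra.
Qed.

(* Each code accounts for at most the total probability, scaled by the ratio of
   the weights of the restriction and of its encoding. *)
Lemma Pr_Rp_encoding (A : finType) (dec : A -> restriction n -> {set 'I_n})
    (E : pred (restriction n)) (t : nat) : p < 1 ->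
  (forall rho, E rho -> exists a, exists tau,
     [/\ dec a tau \subset dom tau, #|dec a tau| = t
       & clear (dec a tau) tau = rho]) ->
  Pr_Rp p E <= #|A|%:R * (2 * p / (1 - p)) ^+ t.
Proof.
move=> p1 enc.
pose good (z : A * restriction n) :=
  (dec z.1 z.2 \subset dom z.2) && (#|dec z.1 z.2| == t).
pose f (z : A * restriction n) := clear (dec z.1 z.2) z.2.
have -> : #|A|%:R * (2 * p / (1 - p)) ^+ t =
    \sum_(z : A * restriction n) Rp_weight p z.2 * (2 * p / (1 - p)) ^+ t.
  rewrite -(pair_bigA _ (fun _ tau => Rp_weight p tau * (2 * p / (1 - p)) ^+ t)).
  rewrite /= sumr_const -mulr_suml.
  by have := Pr_Rp_total n p; rewrite /Pr_Rp => ->; rewrite mul1r mulr_natl.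
have r0 : 0 <= (2 * p / (1 - p)) ^+ t.
  by have /andP[p0 _] := p01; apply/exprn_ge0/divr_ge0; lra.
apply: (@le_trans _ _ (\sum_(z | good z) Rp_weight p (f z))); last first.
  rewrite [leRHS](bigID good) /= ler_wpDr //.
    by apply: sumr_ge0 => z _; rewrite mulr_ge0 ?Rp_weight_ge0.
  by apply: ler_sum => z /andP[sub /eqP ct]; rewrite /f Rp_weight_clear // ct.
(* The fibre of [f] over each [rho] in [E] contains a code of [rho], hence contributes at least its
   weight. *)
rewrite [leRHS](partition_big f predT) //= /Pr_Rp.
rewrite [leRHS](bigID E) /= ler_wpDr //.
  by do 2![apply: sumr_ge0 => ? _]; apply: Rp_weight_ge0.
apply: ler_sum => rho /enc[a [tau [sub ct cl]]].
rewrite (bigD1 (a, tau)) /=; last by rewrite /good /f /= sub ct cl !eqxx.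
rewrite {1}/f /= cl lerDl.
by apply: sumr_ge0 => ? _; apply: Rp_weight_ge0.
Qed.

End Weight.

(** * Codes of fixed length *)

Section Encoding.
Local Open Scope nat_scope.
Variables (n k M l t : nat) (Fs : M.-tuple (cnf n)).
Hypothesis kFs : forall i, kcnf k (tnth Fs i).
Hypotheses (l0 : 0 < l) (t0 : 0 < t).

Definition code := (t.-tuple (token k) * (ceil_div t l).-tuple 'I_M)%type.

Definition code_dec (a : code) (tau : restriction n) : {set 'I_n} :=
  decode a.1 (map (tnth Fs) a.2, tau, no_restr, no_restr).

Lemma CCDT_depth_code rho : t <= CCDT_depth k l Fs rho ->
  exists a : code, exists tau,
  [/\ code_dec a tau \subset dom tau, #|code_dec a tau| = t
    & clear (code_dec a tau) tau = rho].
Proof.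
move=> /(leq_CCDT_depth _ _ _ _ t0)[T HT tT].
have aFs : all (kcnf k) Fs by apply/all_tnthP.
have [sigma [ts [Gs [dj cs st [sG GF] dec]]]] := CCDT_encode l0 aFs HT tT.
(* Padding the list of formulas needs an index in ['I_M]; since [0 < t], decoding uses at least one
   formula. *)
have [G GFs] : exists G, G \in tval Fs.
  case: Gs {sG} GF dec => [|G Gs] GF dec; last by exists G; apply: GF; rewrite mem_head.
  have := dec [::]; case: ts st {dec} => [|[[[j a] b] m] ts] /= st e.
    by move: t0; rewrite -st.
  by move: t0; rewrite -cs -e cards0.
have [is_ eis] : exists is_ : seq 'I_M, Gs = map (tnth Fs) is_.
  elim: Gs GF {sG dec} => [|H Gs IH] GF; first by exists [::].
  have [|is_ ->] := IH; first by move=> K KG; apply: GF; rewrite inE KG orbT.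
  have /tnthP[i ->] := GF H (mem_head _ _).
  by exists (i :: is_).
have /tnthP[i _] := GFs.
have sz : size (is_ ++ nseq (ceil_div t l - size is_) i) == ceil_div t l.
  by rewrite size_cat size_nseq subnKC // -(size_map (tnth Fs)) -eis.
exists (tcast st (in_tuple ts), Tuple sz), (comp rho sigma).
have -> : code_dec (tcast st (in_tuple ts), Tuple sz) (comp rho sigma) = dom sigma.
  by rewrite /code_dec /= val_tcast map_cat -eis dec.
by rewrite cs clear_comp // dom_comp subsetUr.
Qed.

End Encoding.

Theorem theorem3p9 (R : realFieldType) (n k M l t : nat)
    (Fs : M.-tuple (cnf n)) (p : R) :
  (forall i : 'I_M, kcnf k (tnth Fs i)) ->
  0 <= p <= 1 -> (1 <= l)%N -> (1 <= t)%N ->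
  Pr_Rp p (fun rho : restriction n => (t <= CCDT_depth k l Fs rho)%N)
    <= M%:R ^+ ceil_div t l * (32%:R * p * k%:R) ^+ t.
Proof.
move=> kFs p01 l1 t1; have /andP[p0 p1] := p01.
have enc := CCDT_depth_code kFs l1 t1.
have rhs0 : 0 <= M%:R ^+ ceil_div t l * (32%:R * p * k%:R) ^+ t :> R.
  by rewrite mulr_ge0 ?exprn_ge0 ?mulr_ge0 ?ler0n.
(* An empty event has probability 0; otherwise some code exists, and its entries in ['I_k] and
   ['I_M] make [k] and [M] positive. *)
case: (boolP [exists rho : restriction n, (t <= CCDT_depth k l Fs rho)%N]);
  last first.
  rewrite negb_exists => /forallP none; rewrite /Pr_Rp big1 // => rho E.
  by have := none rho; rewrite E.
case/existsP=> rho0 /enc[[ts is_] _].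
have k0 : (0 < k)%N.
  exact: leq_ltn_trans (leq0n _) (ltn_ord (tnth ts (Ordinal t1)).1.1.1).
have c0 : (0 < ceil_div t l)%N by rewrite /ceil_div divn_gt0 //; lia.
have M0 : (0 < M)%N := leq_ltn_trans (leq0n _) (ltn_ord (tnth is_ (Ordinal c0))).
have M1 : 1 <= M%:R ^+ ceil_div t l :> R by rewrite exprn_ege1 // ler1n.
have k1 : 1 <= k%:R :> R by rewrite ler1n.
case: (lerP 1 (32%:R * p * k%:R)) => [big|small].
  apply: le_trans (Pr_Rp_le1 p01 _) _.
  by apply: le_trans M1 _; rewrite ler_peMr ?exprn_ege1 ?exprn_ge0 ?ler0n.
have p32 : 32 * p < 1.
  by apply: le_lt_trans small; rewrite ler_peMr // mulr_ge0.
apply: le_trans (Pr_Rp_encoding p01 _ enc) _; first by lra.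
rewrite card_prod !card_tuple card_token card_ord mulnC natrM !natrX -mulrA.
rewrite ler_wpM2l ?exprn_ge0 // -exprMn lerXn2r ?nnegrE //.
- by rewrite mulr_ge0 // divr_ge0; lra.
- by rewrite !mulr_ge0.
have pk0 : 0 <= p * k%:R by rewrite mulr_ge0.
(* Up to the factor [p * k], this is [24 <= 32 * (1 - p)], which [p32] gives. *)
rewrite natrM !mulrA ler_pdivrMr; last by lra.
by nra.
Qed.
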